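(* Let $p>1$, $q>1$ with $p^{-1}+q^{-1}>1$. There exists a constant $C_{p,q}<+\infty$, depending on $p$ and $q$ only, such that the following holds. Let $E,V$ be Banach spaces, $a<b$ real numbers, and let $f\in\mathcal{U}^{p}([a,b],L(E,V))$ and $g\in\mathcal{U}^{q}([a,b],E)$ have no common points of discontinuity. Then the Riemann-Stieltjes integral $\int_{a}^{b}f\,\mathrm{d}g$ exists, and $$\left\|\int_{a}^{b}f\,\mathrm{d}g-f(a)[g(b)-g(a)]\right\|_{V}\le C_{p,q}\,\|f\|_{p\text{-TV},[a,b]}^{p-p/q}\,\|f\|_{\mathrm{osc},[a,b]}^{1+p/q-p}\,\|g\|_{q\text{-TV},[a,b]}.$$
   Context: $L(E,V)$ is the Banach space of continuous linear maps $E\to V$ with the operator norm. For a Banach space $W$, $h:[a,b]\to W$ and $\delta\ge0$, the truncated variation is $$\mathrm{TV}^{\delta}(h,[a,b]):=\sup_{n}\ \sup_{a\le t_{0}<t_{1}<\ldots<t_{n}\le b}\ \sum_{i=1}^{n}\max\{\|h(t_{i})-h(t_{i-1})\|_W-\delta,0\}.$$ For $p\ge1$, $\mathcal{U}^{p}([a,b],W)$ is the set of functions $h:[a,b]\to W$ with $\sup_{\delta>0}\delta^{p-1}\mathrm{TV}^{\delta}(h,[a,b])<+\infty$, and $\|h\|_{p\text{-TV},[a,b]}:=\left(\sup_{\delta>0}\delta^{p-1}\mathrm{TV}^{\delta}(h,[a,b])\right)^{1/p}$. Also $\|h\|_{\mathrm{osc},[a,b]}:=\sup_{a\le s<t\le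 b}\|h(s)-h(t)\|_{W}$. $f(\xi)[g(t)-g(s)]\in V$ denotes the value of the linear map $f(\xi)$ at the vector $g(t)-g(s)$. The Riemann-Stieltjes integral $\int_a^b f\,\mathrm{d}g\in V$ is the common limit (if it exists) of the sums $\sum_{i}f(\xi_{i})[g(t_{i})-g(t_{i-1})]$ over all sequences of tagged partitions $a=t_0<t_1<\dots<t_n=b$, $\xi_i\in[t_{i-1},t_i]$, with mesh $\max_i(t_i-t_{i-1})$ tending to $0$. *)

(* Defs.v *)
From HB Require Import structures.
From mathcomp Require Import all_boot all_order all_algebra.
From mathcomp Require Import boolp classical_sets functions reals ereal.
From mathcomp Require Import interval_inference topology normedtype sequences.
From mathcomp Require Import exp.

Set Implicit Arguments.
Unset Strict Implicit.
Unset Printing Implicit Defensive.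

Import Order.TTheory GRing.Theory Num.Theory.
Import numFieldTopology.Exports numFieldNormedType.Exports.

Local Open Scope classical_set_scope.
Local Open Scope ring_scope.

(* [contlin E V] is L(E, V), a complete normed module for the operator norm
   [opnorm]. *)
Section contlin.
Context {R : realType} {E V : normedModType R}.

Definition contlin_pred : {pred E -> V} :=
  [pred L : E -> V | `[< linear L /\ continuous L >]].

Lemma contlin_predP (L : E -> V) :
  reflect (linear L /\ continuous L) (L \in contlin_pred).
Proof. by rewrite inE; exact: asboolP. Qed.

Lemma contlin_submod_closed : submod_closed contlin_pred.
Proof.
split; first by apply/contlin_predP; split=> [k x y|x];
  rewrite /= ?scaler0 ?addr0//; exact: cvg_cst.
move=> a f g /contlin_predP[lf cf] /contlin_predP[lg cg].
apply/contlin_predP; split=> [k x y|x].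
  change (a *: f (k *: x + y) + g (k *: x + y) =
    k *: (a *: f x + g x) + (a *: f y + g y)).
  by rewrite lf lg !scalerDr !scalerA (mulrC a) addrACA.
change ((fun x => a *: f x + g x) @ x --> a *: f x + g x).
by apply: cvgD; [apply: cvgZl_tmp; exact: cf|exact: cg].
Qed.

HB.instance Definition _ := GRing.isSubmodClosed.Build R (E -> V)%type
  contlin_pred contlin_submod_closed.

Record contlin : Type := ContLin {
  contlin_fun :> E -> V ;
  contlinP : contlin_fun \in contlin_pred }.

HB.instance Definition _ := [isSub for contlin_fun].
HB.instance Definition _ := [Choice of contlin by <:].
HB.instance Definition _ := [SubChoice_isSubLmodule of contlin by <:].

Lemma contlin_linear (L : contlin) : linear L.
Proof. by have /contlin_predP[] := contlinP L. Qed.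

Lemma contlin_continuous (L : contlin) : continuous L.
Proof. by have /contlin_predP[] := contlinP L. Qed.

HB.instance Definition _ (L : contlin) :=
  GRing.isLinear.Build R E V *:%R L (contlin_linear L).

Definition opnorm (L : contlin) : R := sup [set `|L x| | x in [set x | `|x| <= 1]].

Lemma contlin_bounded (L : contlin) :
  exists2 M : R, 0 < M & forall x, `|L x| <= M * `|x|.
Proof.
have /linear_boundedP/pinfty_ex_gt0[M M0 LM] :=
  (linear_bounded_continuous L).2 (@contlin_continuous L).
by exists M.
Qed.

Lemma opnorm_has_sup (L : contlin) :
  has_sup [set `|L x| | x in [set x | `|x| <= 1]].
Proof.
split; first by exists `|L 0|, 0 => //=; rewrite normr0.
have [M M0 LM] := contlin_bounded L; exists M => _ [x /= x1 <-].
by rewrite (le_trans (LM x))// ler_piMr// ltW.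
Qed.

Lemma opnorm_ge0 (L : contlin) : 0 <= opnorm L.
Proof.
apply: (le_trans (normr_ge0 (L 0))).
by apply: (sup_upper_bound (opnorm_has_sup L)); exists 0 => //=; rewrite normr0.
Qed.

Lemma ler_opnorm (L : contlin) x : `|L x| <= opnorm L * `|x|.
Proof.
have [->|x0] := eqVneq x 0; first by rewrite linear0 !normr0 mulr0.
have nx : 0 < `|x| by rewrite normr_gt0.
rewrite -ler_pdivrMr//.
have -> : `|L x| / `|x| = `|L (`|x|^-1 *: x)|.
  by rewrite linearZ normrZ ger0_norm ?invr_ge0// mulrC.
apply: (sup_upper_bound (opnorm_has_sup L)); exists (`|x|^-1 *: x) => //=.
by rewrite normrZ ger0_norm ?invr_ge0// mulVf// normr_eq0.
Qed.

Lemma opnorm_le (L : contlin) (M : R) :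
  (forall x, `|x| <= 1 -> `|L x| <= M) -> opnorm L <= M.
Proof.
move=> LM; apply: ge_sup; first exact: (opnorm_has_sup L).1.
by move=> _ [x /= x1 <-]; exact: LM.
Qed.

Lemma opnormD (K L : contlin) : opnorm (K + L) <= opnorm K + opnorm L.
Proof.
apply: opnorm_le => x x1.
change (`|K x + L x| <= opnorm K + opnorm L).
rewrite (le_trans (ler_normD _ _))// lerD// (le_trans (ler_opnorm _ _))//;
  by rewrite ler_piMr// opnorm_ge0.
Qed.

Lemma opnormZ_le (k : R) (L : contlin) : opnorm (k *: L) <= `|k| * opnorm L.
Proof.
apply: opnorm_le => x x1; change (`|k *: L x| <= `|k| * opnorm L).
rewrite normrZ ler_wpM2l// (le_trans (ler_opnorm _ _))//.
by rewrite ler_piMr// opnorm_ge0.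
Qed.

Lemma opnormZ (k : R) (L : contlin) : opnorm (k *: L) = `|k| * opnorm L.
Proof.
apply/eqP; rewrite eq_le opnormZ_le/=.
have [->|k0] := eqVneq k 0; first by rewrite normr0 mul0r opnorm_ge0.
rewrite -ler_pdivlMl ?normr_gt0// -normfV.
by rewrite -{1}[L](scalerK k0) opnormZ_le.
Qed.

Lemma opnorm0_eq0 (L : contlin) : opnorm L = 0 -> L = 0.
Proof.
move=> L0; apply/val_inj/funext => x.
by apply/eqP; have := ler_opnorm L x; rewrite L0 mul0r normr_le0.
Qed.

HB.instance Definition _ :=
  Lmodule_isNormed.Build R contlin opnormD opnormZ opnorm0_eq0.

End contlin.
Arguments contlin {R} E V.

Section contlin_complete.
Context {R : realType} {E : normedModType R} {V : completeNormedModType R}.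

Lemma ler_dist_contlin (K L : contlin E V) x : `|K x - L x| <= `|K - L| * `|x|.
Proof. exact: (ler_opnorm (K - L) x). Qed.

Lemma contlin_complete (F : set_system (contlin E V)) :
  ProperFilter F -> cauchy F -> cvg F.
Proof.
move=> FF Fc.
have {}Fc (e : R) : 0 < e -> exists K : contlin E V, \forall L \near F, `|K - L| < e.
  by move=> e0; have [K] := (cauchyP F).1 Fc e e0;
    rewrite -ball_normE => ?; exists K.
have Fx x : cvg ((fun L : contlin E V => L x) @ F).
  apply: cauchy_cvg; apply: cauchy_exP => e e0.
  have x1 : 0 < `|x| + 1 by rewrite ltr_wpDl.
  have [K FK] := Fc _ (divr_gt0 e0 x1).
  exists (K x); rewrite -ball_normE; apply: filterS FK => L /= KL.
  rewrite (le_lt_trans (ler_dist_contlin K L x))//.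
  rewrite -(divfK (lt0r_neq0 x1) e) (@le_lt_trans _ _ (`|K - L| * (`|x| + 1)))//.
    by rewrite ler_wpM2l// lerDl.
  by rewrite ltr_pM2r.
pose G x := lim ((fun L : contlin E V => L x) @ F).
have FG x : (fun L : contlin E V => L x) @ F --> G x by exact: Fx.
have linG : linear G.
  move=> k x y; apply/cvg_lim => //.
  have -> : (fun L : contlin E V => L (k *: x + y)) =
            (fun L : contlin E V => k *: L x + L y).
    by apply/funext => L; rewrite linearP.
  by apply: cvgD; [apply: cvgZl_tmp; exact: FG|exact: FG].
have dist_le (e : R) (K : contlin E V) : (\forall L \near F, `|K - L| < e) ->
    forall x, `|K x - G x| <= e * `|x|.
  move=> FK x; apply: (@closed_cvg _ _ F FF (fun L : contlin E V => K x - L x)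
    [set v | `|v| <= e * `|x|]).
  - rewrite (_ : [set _ | _] = (Num.norm : V -> R) @^-1` [set y | y <= e * `|x|])//.
    by apply: preimage_closed => [? _|]; [exact: norm_continuous|exact: closed_le].
  - apply: filterS FK => L /ltW KL /=.
    by rewrite (le_trans (ler_dist_contlin K L x))// ler_wpM2r.
  - by apply: cvgB; [exact: cvg_cst|exact: FG].
pose GL := GRing.isLinear.Build R E V *:%R G linG.
pose Glin : {linear E -> V} := HB.pack G GL.
have contG : continuous G.
  apply: (@bounded_linear_continuous _ _ _ Glin); apply/linear_boundedP.
  have [K FK] := Fc 1 ltr01.
  near=> r => x; have -> : Glin x = K x - (K x - G x) by rewrite opprB addrC subrK.
  rewrite (le_trans (ler_normB _ _))//.
  rewrite (le_trans (lerD (ler_opnorm K x) (dist_le _ _ FK x)))//.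
  by rewrite -mulrDl ler_wpM2r//; near: r; apply: nbhs_pinfty_ge; rewrite num_real.
have GP : G \in contlin_pred by apply/contlin_predP.
apply/cvg_ex; exists (ContLin GP); apply/cvgrPdist_lt => e e0.
have [K FK] := Fc _ (divr_gt0 e0 (ltr0n _ 3)).
apply: filterS (FK) => L KL /=.
have GK : `|ContLin GP - K| <= e / 3.
  apply: opnorm_le => x x1.
  change (`|G x - K x| <= e / 3); rewrite distrC.
  by rewrite (le_trans (dist_le _ _ FK x))// ler_piMr// divr_ge0// ltW.
rewrite -(subrKA K) (le_lt_trans (ler_normD _ _))//.
rewrite (lt_trans (ler_ltD GK KL))// -mulrDl ltr_pdivrMr//.
by rewrite [ltRHS]mulr_natr mulrS mulr2n ltrDr.
Unshelve. all: by end_near. Qed.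

HB.instance Definition _ := Uniform_isComplete.Build (contlin E V) contlin_complete.

End contlin_complete.

(* A function on [a, b] is represented by a total function on R, of which only
   the restriction to [a, b] is ever inspected. *)
Section variation.
Context {R : realType} {W : normedModType R}.
Implicit Types (h : R -> W) (a b delta p t : R).

Definition trunc_var delta h a b : \bar R :=
  ereal_sup [set x | exists (n : nat) (t : nat -> R),
    [/\ a <= t 0%N,
        forall i, (i < n)%N -> t i < t i.+1,
        t n <= b &
        x = (\sum_(i < n) Num.max (`|h (t i.+1) - h (t i)| - delta) 0)%:E]].

Definition pTV_sup p h a b : \bar R :=
  ereal_sup [set ((delta `^ (p - 1))%:E * trunc_var delta h a b)%E
              | delta in [set delta : R | 0 < delta]].

Definition Up p a b : set (R -> W) := [set h | (pTV_sup p h a b < +oo)%E].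

Definition pTV_norm p h a b : \bar R := (pTV_sup p h a b `^ p^-1)%E.

Definition osc_norm h a b : \bar R :=
  ereal_sup [set x | exists s t, [/\ a <= s, s < t, t <= b &
    x = `|h s - h t|%:E]].

(* Continuity at [t] of the restriction of [h] to [a, b]: one-sided at the end
   points. *)
Definition continuous_in_at h a b t : Prop :=
  h x @[x --> within `[a, b]%classic (nbhs t)] --> h t.

End variation.

Definition no_common_discontinuity {R : realType} {W W' : normedModType R}
    (f : R -> W) (g : R -> W') (a b : R) : Prop :=
  forall t, t \in `[a, b] ->
    ~ (~ continuous_in_at f a b t /\ ~ continuous_in_at g a b t).

Section riemann_stieltjes.
Context {R : realType} {E V : normedModType R}.
Implicit Types (a b : R) (f : R -> contlin E V) (g : R -> E).

(* Only the nodes of index at most [tp_size] and the tags of index less than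
   [tp_size] are relevant; [tp_tag i] belongs to the [i]-th interval, counted
   from 0. *)
Record tagged_partition a b : Type := TaggedPartition {
  tp_size : nat ;
  tp_node : nat -> R ;
  tp_tag : nat -> R ;
  tp_node_first : tp_node 0%N = a ;
  tp_node_last : tp_node tp_size = b ;
  tp_node_lt : forall i, (i < tp_size)%N -> tp_node i < tp_node i.+1 ;
  tp_tag_in : forall i, (i < tp_size)%N ->
    tp_tag i \in `[tp_node i, tp_node i.+1] }.

Definition tp_mesh a b (P : tagged_partition a b) : R :=
  \big[Num.max/0]_(i < tp_size P) (tp_node P i.+1 - tp_node P i).

Definition RS_sum f g a b (P : tagged_partition a b) : V :=
  \sum_(i < tp_size P)
    f (tp_tag P i) (g (tp_node P i.+1) - g (tp_node P i)).

Definition is_RS_integral f g a b (I : V) : Prop :=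
  forall P : nat -> tagged_partition a b,
    tp_mesh (P k) @[k --> \oo] --> (0 : R) ->
    RS_sum f g (P k) @[k --> \oo] --> I.

End riemann_stieltjes.

(* Main.v *)
Require Import Defs.
From mathcomp Require Import all_boot all_order all_algebra.
From mathcomp Require Import boolp classical_sets functions reals ereal.
From mathcomp Require Import interval_inference topology normedtype sequences.
From mathcomp Require Import exp.
From mathcomp Require Import ring lra zify.

(** Young's argument, run with a weak rather than a strong variation. All that is
used of [h] in U^p, with A = ||h||_p-TV, is that along any increasing chain of
times at most (2A/x)^p increments exceed [x]. So as long as [k] pieces of a
Riemann sum can be merged into their left neighbours, one of the merges costs at
most x_k y_k, with x_k of order k^(-1/p) and y_k of order k^(-1/q), and the
series of these costs converges because 1/p + 1/q > 1. Capping x_k by the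
oscillation of [f] and merging everything gives the estimate. To compare two fine
partitions, pass through the left sums over the partitions and over a common
refinement: since there is no common discontinuity, each merge inside a short
interval also costs at most eps, and sum_k min(eps, x_k y_k) tends to 0 with
eps; the sums are therefore Cauchy. *)

Set Implicit Arguments.
Unset Strict Implicit.
Unset Printing Implicit Defensive.

Import Order.TTheory GRing.Theory Num.Theory.
Import numFieldTopology.Exports numFieldNormedType.Exports.

Local Open Scope classical_set_scope.
Local Open Scope ring_scope.

(** * Counting large increments along a chain of times *)

Section chains.
Context {R : realType} {W : normedModType R}.
Implicit Types (h : R -> W) (a b x t p : R) (s : seq R).

Fixpoint chain_var x h t s : R :=
  if s is u :: s' then Num.max (`|h u - h t| - x) 0 + chain_var x h u s' else 0.

Fixpoint jumps x h t s : nat :=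
  if s is u :: s' then ((x < `|h u - h t|)%R + jumps x h u s')%N else 0%N.

Lemma chain_var_le_trunc_var x h a b t s : 0 <= x ->
  a <= t -> path <=%R t s -> last t s <= b ->
  ((chain_var x h t s)%:E <= trunc_var x h a b)%E.
Proof.
move=> x0 at_ pts lb; apply: ereal_sup_ubound => /=.
suff [n [u [u0 un ul us]]] : exists (n : nat) (u : nat -> R),
    [/\ u 0%N = t, (forall i, (i < n)%N -> u i < u i.+1), u n = last t s &
    chain_var x h t s = \sum_(i < n) Num.max (`|h (u i.+1) - h (u i)| - x) 0].
  by exists n, u; split => //; [rewrite u0|rewrite ul|rewrite us].
elim: s t {at_ lb} pts => [|y s IH] t /=.
  by move=> _; exists 0%N, (fun=> t); split => //; rewrite big_ord0.
case/andP; rewrite le_eqVlt => /predU1P[<-|ty] /IH [n [u [u0 un ul us]]].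
  by exists n, u; split => //; rewrite subrr normr0 sub0r max_r ?add0r ?oppr_le0.
exists n.+1, (fun i => if i is j.+1 then u j else t); split => //.
  by case=> [|i] /= i_n; [rewrite u0|exact: un].
by rewrite big_ord_recl/= us u0.
Qed.

(** An increment above [2 * x] keeps more than [x] after truncation at [x]. *)
Lemma jumps_le_chain_var x h t s : 0 <= x ->
  (jumps (2 * x) h t s)%:R * x <= chain_var x h t s.
Proof.
move=> x0; elim: s t => [|u s IH] t /=; first by rewrite mul0r.
rewrite natrD mulrDl lerD//; have [xh|_] := ltP (2 * x) `|h u - h t|.
  by rewrite mul1r le_max; apply/orP; left; lra.
by rewrite mul0r le_max lexx orbT.
Qed.

Lemma pTV_sup_ge0 p h a b : a <= b -> (0 <= pTV_sup p h a b)%E.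
Proof.
move=> ab; apply: (@le_trans _ _ ((1 `^ (p - 1))%:E * trunc_var 1 h a b)%E).
  rewrite mule_ge0 ?lee_fin ?powR_ge0//.
  exact: (@chain_var_le_trunc_var 1 h a b a [::]).
by apply: ereal_sup_ubound => /=; exists 1 => //; rewrite /= ltr01.
Qed.

Lemma pTV_norm_fin_num p h a b : a <= b -> Up p a b h ->
  pTV_norm p h a b = (fine (pTV_norm p h a b))%:E /\
  0 <= fine (pTV_norm p h a b).
Proof.
move=> ab hU; have n0 : (0 <= pTV_norm p h a b)%E by exact: poweR_ge0.
by rewrite fineK ?fine_ge0// ge0_fin_numE// poweR_lty.
Qed.

(** A weak-type estimate: at truncation level [x / 2] each jump contributes at least [x / 2], so the
    number of jumps times [(x / 2) ^ p] is at most the [p]-th power of the norm. *)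
Lemma jumps_bound p h a b t s x : 1 < p -> Up p a b h -> 0 < x ->
  a <= t -> path <=%R t s -> last t s <= b ->
  (jumps x h t s)%:R * x `^ p <= (2 * fine (pTV_norm p h a b)) `^ p.
Proof.
move=> p1 hU x0 at_ ts sb.
have ab : a <= b.
  apply: le_trans at_ (le_trans _ sb); elim: s t ts {sb} => //= u s IH t.
  by case/andP=> tu /IH; exact: le_trans.
have p0 : p != 0 by rewrite gt_eqF// (lt_trans ltr01).
have S0 := pTV_sup_ge0 p h ab.
have Sfin : pTV_sup p h a b \is a fin_num by rewrite ge0_fin_numE.
have x20 : 0 < x / 2 by rewrite divr_gt0.
have tvS : (x / 2) `^ (p - 1) * chain_var (x / 2) h t s <= fine (pTV_sup p h a b).
  rewrite -lee_fin fineK//.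
  apply: (@le_trans _ _ (((x / 2) `^ (p - 1))%:E * trunc_var (x / 2) h a b)%E).
    rewrite EFinM lee_wpmul2l ?lee_fin ?powR_ge0//.
    by apply: chain_var_le_trunc_var => //; exact: ltW.
  by apply: ereal_sup_ubound => /=; exists (x / 2).
rewrite powRM// ?fine_ge0 ?poweR_ge0// fine_poweR -powRrM mulVf// powRr1 ?fine_ge0//.
rewrite -ler_pdivrMl ?powR_gt0//; apply: le_trans tvS.
have := jumps_le_chain_var h t s (ltW x20).
have x2 : 2 * (x / 2) = x by rewrite mulrC divfK.
rewrite x2 => jx.
apply: le_trans (ler_wpM2l (powR_ge0 _ _) jx).
have -> : x `^ p = 2 `^ p * (x / 2) `^ p.
  by rewrite -powRM ?x2// ltW.
rewrite -(@mulr_powRB1 _ (x / 2) p) ?(ltW x20) ?(lt_trans ltr01)//.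
have t0 : 0 < (2:R) `^ p by exact: powR_gt0.
set T := 2 `^ p; set Y := (x / 2) `^ _; set J := _%:R.
have -> : T^-1 * (J * (T * (x / 2 * Y))) = (T^-1 * T) * (Y * (J * (x / 2))) by ring.
by rewrite mulVf ?mul1r// gt_eqF.
Qed.

End chains.

(* In a list of pieces, each one contributes [f tag (g right - g r)], where [r] is
   the right end of its predecessor. Consecutive pieces with equal bases are meant
   to be merged, which leaves one piece per base, with the base as its tag. *)
Record piece (R : Type) := Piece { tag : R; right : R; base : R }.

(** * Merging consecutive pieces *)

Section merging.
Context {R : realType} {E V : normedModType R}.
Variables (f : R -> contlin E V) (g : R -> E).
Implicit Types (a b d t : R) (x y z : piece R) (s l r : seq (piece R)).

Fixpoint piece_sum (F : piece R -> R) t s : V :=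
  if s is y :: s' then f (F y) (g (right y) - g t) + piece_sum F (right y) s'
  else 0.

Lemma piece_sum_cat F t l : exists S : V,
  forall s', piece_sum F t (l ++ s') =
    S + piece_sum F (last t (map (@right R) l)) s'.
Proof.
elim: l t => [|x l IH] t /=; first by exists 0 => s'; rewrite add0r.
have [S HS] := IH (right x).
by exists (f (F x) (g (right x) - g t) + S) => s'; rewrite HS addrA.
Qed.

(** By the last clause, a run of equal bases opens with a piece tagged by its base; merging the
    whole run to the left therefore leaves the base as tag. *)
Definition piece_le x y :=
  [&& tag x <= tag y, right x <= right y & (base y == base x) || (tag y == base y)].

Definition piece_in a b d x :=
  [&& a <= base x, base x <= tag x, tag x <= right x, right x <= b &
      right x <= base x + d].

Fixpoint mergeable z s : nat :=
  if s is y :: s' then ((base y == base z) + mergeable y s')%N else 0%N.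

Definition merge_pieces x y := Piece (tag x) (right y) (base x).

(** Pigeonhole: if every mergeable position showed a jump of [f] along the tags or of [g] along the
    right ends, there would be at least as many jumps as mergeable positions. *)
Lemma exists_small_merge (X Y : R) z s :
  (jumps X f (tag z) (map (@tag R) s) + jumps Y g (right z) (map (@right R) s)
    < mergeable z s)%N ->
  exists l x y r, [/\ z :: s = l ++ x :: y :: r, base y = base x,
    `|f (tag y) - f (tag x)| <= X & `|g (right y) - g (right x)| <= Y].
Proof.
elim: s z => [|y s IH] z //= Hm.
have [/andP[/andP[/eqP yz fX] gY]|bad] := boolP ((base y == base z) &&
    (`|f (tag y) - f (tag z)| <= X) && (`|g (right y) - g (right z)| <= Y)).
  by exists [::], z, y, s.
have /IH [l [x [x' [r [-> e1 e2 e3]]]]] : (jumps X f (tag y) (map (@tag R) s)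
    + jumps Y g (right y) (map (@right R) s) < mergeable y s)%N.
  move: bad Hm; rewrite !ltNge.
  case: (base y == base z); case: (_ <= X); case: (_ <= Y) => //= _;
  by rewrite -?ltnNge => H; lia.
by exists (z :: l), x, x', r.
Qed.

Lemma mergeable_merge z l x y r : base y = base x ->
  mergeable z (l ++ x :: y :: r) = (mergeable z (l ++ merge_pieces x y :: r)).+1.
Proof.
move=> yx; elim: l z => [|w l IH] z /=; last by rewrite IH addnS.
by rewrite yx eqxx add1n addnS; case: r => //= w r; rewrite yx.
Qed.

Lemma path_merge z l x y r : base y = base x ->
  path piece_le z (l ++ x :: y :: r) -> path piece_le z (l ++ merge_pieces x y :: r).
Proof.
move=> yx; rewrite !cat_path => /andP[-> /=].
case/and3P=> /and3P[a1 a2 a3] /and3P[b1 b2 b3] pr.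
rewrite /piece_le/= a1 (le_trans a2 b2) a3/=.
case: r pr => //= w r /andP[/and3P[c1 c2 c3] ->].
by rewrite /piece_le/= (le_trans b1 c1) c2 -yx c3.
Qed.

Lemma piece_in_merge a b d x y : base y = base x -> piece_le x y ->
  piece_in a b d x -> piece_in a b d y -> piece_in a b d (merge_pieces x y).
Proof.
move=> yx /and3P[_ b2 _] /and5P[a1 a2 a3 _ _] /and5P[_ _ _ c4 c5].
by rewrite /piece_in/= a1 a2 (le_trans a3 b2) c4 -yx c5.
Qed.

(** Only the stretch from [right x] to [right y] is affected: its evaluation point moves from
    [tag y] to [tag x]. *)
Lemma piece_sum_tag_merge t l x y r :
  piece_sum (@tag R) t (l ++ x :: y :: r)
  - piece_sum (@tag R) t (l ++ merge_pieces x y :: r)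
  = (f (tag y) - f (tag x)) (g (right y) - g (right x)).
Proof.
have [S HS] := piece_sum_cat (@tag R) t l; rewrite !HS /=.
move: (last _ _) => u.
have -> : g (right y) - g u = (g (right x) - g u) + (g (right y) - g (right x)).
  by rewrite [RHS]addrC subrKA.
rewrite [f _ (_ - _ + _)]linearD.
have cancel (S' P Q Q' T : V) : S' + (P + (Q + T)) - (S' + (P + Q' + T)) = Q - Q'.
  rewrite opprD addrACA subrr add0r -[P + Q' + T]addrA opprD addrACA subrr add0r.
  by rewrite opprD addrACA subrr addr0.
exact: cancel.
Qed.

(** Both pieces apply the same linear map, so additivity makes the sum over bases an invariant of
    merging; it is the value reached once everything is merged. *)
Lemma piece_sum_base_merge t l x y r : base y = base x ->
  piece_sum (@base R) t (l ++ x :: y :: r) =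
  piece_sum (@base R) t (l ++ merge_pieces x y :: r).
Proof.
move=> yx; have [S HS] := piece_sum_cat (@base R) t l; rewrite !HS /= yx.
move: (last _ _) => u.
have -> : g (right y) - g u = (g (right x) - g u) + (g (right y) - g (right x)).
  by rewrite [RHS]addrC subrKA.
by rewrite [f _ (_ - _ + _)]linearD; congr (_ + _); exact: addrA.
Qed.

Lemma piece_sum_unmergeable z t s : mergeable z s = 0%N -> path piece_le z s ->
  piece_sum (@tag R) t s = piece_sum (@base R) t s.
Proof.
elim: s z t => //= y s IH z t /eqP; rewrite addn_eq0 eqb0 => /andP[yz /eqP m0].
move=> /andP[/and3P[_ _]]; rewrite (negbTE yz)/= => /eqP e ps.
by rewrite e (IH _ _ m0 ps).
Qed.

(** Thresholds and costs stay abstract because merging is used twice: with [d = b - a] and costs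
    capped by the oscillation for the estimate, and with a small [d] and a small cap for the Cauchy
    property. *)
Variables (a b d : R) (X Y c : nat -> R).
Hypothesis ab : a <= b.
Hypothesis few_jumps : forall k t t' (s s' : seq R), (0 < k)%N ->
  a <= t -> path <=%R t s -> last t s <= b ->
  a <= t' -> path <=%R t' s' -> last t' s' <= b ->
  (jumps (X k) f t s + jumps (Y k) g t' s' < k)%N.
Hypothesis merge_cost : forall k (v x x' u u' : R), (0 < k)%N ->
  a <= v -> v <= x -> x <= x' -> x' <= v + d -> x' <= b ->
  v <= u -> u <= u' -> u' <= v + d -> u' <= b ->
  `|f x' - f x| <= X k -> `|g u' - g u| <= Y k ->
  `|f x' - f x| * `|g u' - g u| <= c k.

(* The base of [root_piece] lies outside [a, b], so that no piece merges into it and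
   the first piece of a chain starting at [root_piece] is forced to have its base as
   tag. *)
Definition root_piece := Piece a a (a - 1).

(** Induction on the number of mergeable positions: while [k] of them remain there are fewer than
    [k] jumps, so some merge costs at most [c k]; when none remains, tags and bases agree. *)
Lemma piece_sum_merging s :
  path piece_le root_piece s -> all (piece_in a b d) s ->
  `|piece_sum (@tag R) a s - piece_sum (@base R) a s|
    <= \sum_(1 <= k < (mergeable root_piece s).+1) c k.
Proof.
move: {2}(mergeable root_piece s) (erefl (mergeable root_piece s)) => n.
elim: n s => [|n IH] s ns ps ins.
  by rewrite ns big_geq// (piece_sum_unmergeable _ ns ps) subrr normr0.
have last_le : last root_piece s = root_piece \/ piece_in a b d (last root_piece s).
  case: s ins {ns ps} => [|y s] ins; [by left|right].
  by elim: s y ins => [|w s IHs] y /andP[//] _ /IHs.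
have sorted_tag : path <=%R a (map (@tag R) s).
  rewrite -[a]/(tag root_piece) path_map; move: ps.
  by apply: sub_path => ? ? /and3P[].
have sorted_right : path <=%R a (map (@right R) s).
  rewrite -[a]/(right root_piece) path_map; move: ps.
  by apply: sub_path => ? ? /and3P[].
have last_tag : last a (map (@tag R) s) <= b.
  rewrite -[a]/(tag root_piece) last_map; case: last_le => [->//|].
  by case/and5P=> _ _ h1 h2 _; exact: le_trans h1 h2.
have last_right : last a (map (@right R) s) <= b.
  by rewrite -[a]/(right root_piece) last_map; case: last_le => [->//|] /and5P[].
have /exists_small_merge [l [x [y [r [e yx fX gY]]]]] :
    (jumps (X n.+1) f (tag root_piece) (map (@tag R) s)
     + jumps (Y n.+1) g (right root_piece) (map (@right R) s) < mergeable root_piece s)%N.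
  by rewrite ns; exact: few_jumps.
(* If the left partner were [root_piece], the base of [y] would be [a - 1], which is not in
   [a, b]. *)
case: l e => [[ex es]|w l [ew es]].
  move: ins yx; rewrite es -ex /= => /andP[/and5P[ay _ _ _ _] _] yx.
  by move: ay; rewrite yx; lra.
rewrite es in ns ps ins *.
have cxy : piece_le x y.
  by move: ps; rewrite cat_path => /andP[_ /= /and3P[]].
move: ins; rewrite all_cat /= => /and4P[il ix iy ir].
have ns' : mergeable root_piece (l ++ merge_pieces x y :: r) = n.
  by apply: succn_inj; rewrite -mergeable_merge.
have ps' := path_merge yx ps.
have is' : all (piece_in a b d) (l ++ merge_pieces x y :: r).
  by rewrite all_cat /= il ir (piece_in_merge yx cxy ix iy).
have := IH _ ns' ps' is'.
rewrite ns' ns [in X in _ -> _ <= X]big_nat_recr//= (piece_sum_base_merge _ _ _ yx).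
set S1 := piece_sum _ _ (_ ++ merge_pieces _ _ :: _); set S2 := piece_sum (@base R) _ _.
set S0 := piece_sum _ _ _ => H.
have -> : S0 - S2 = (S1 - S2) + (S0 - S1) by rewrite [RHS]addrC subrKA.
apply: le_trans (ler_normD _ _) (lerD H _).
rewrite piece_sum_tag_merge (le_trans (ler_opnorm _ _))//.
case/and5P: ix => x1 x2 x3 x4 x5; case/and5P: iy => y1 y2 y3 y4 y5.
case/and3P: cxy => z1 z2 _; rewrite yx in y1 y2 y5.
apply: (merge_cost (v := base x)) => //.
- exact: le_trans y3 y5.
- exact: le_trans y3 y4.
- exact: le_trans x2 x3.
Qed.

(** * Pieces attached to a tagged partition *)

Fixpoint tagged_pieces (beta t xi : nat -> R) m n : seq (piece R) :=
  if n is n'.+1 then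
    [:: Piece (t m) (t m) (beta m), Piece (xi m) (t m.+1) (beta m)
      & tagged_pieces beta t xi m.+1 n']
  else [::].

(** The degenerate piece at [t m] serves to open a run with a tag equal to the base; its increment
    of [g] vanishes. The alternative on [F] treats tags and bases in one proof. *)
Lemma piece_sum_tagged_pieces (F : piece R -> R) (G beta t xi : nat -> R) u m n :
  t m = u ->
  (forall i u v, F (Piece (xi i) u v) = G i) \/
    (forall i u v, F (Piece u v (beta i)) = G i) ->
  piece_sum F u (tagged_pieces beta t xi m n) =
  \sum_(m <= i < m + n) f (G i) (g (t i.+1) - g (t i)).
Proof.
move=> + FG; elim: n m u => [|n IH] m u /=; first by rewrite addn0 big_geq.
move=> <-; have mn : (m < m + n.+1)%N by lia.
rewrite subrr linear0 add0r (IH _ _ erefl) big_ltn// addSnnS.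
by case: FG => ->.
Qed.

Lemma path_tagged_pieces z (beta t xi : nat -> R) m n :
  (forall i, (m <= i < m + n)%N -> t i <= xi i <= t i.+1) ->
  (forall i, (m <= i < m + n)%N ->
    (beta i.+1 == beta i) || (t i.+1 == beta i.+1)) ->
  tag z <= t m -> right z <= t m -> (beta m == base z) || (t m == beta m) ->
  path piece_le z (tagged_pieces beta t xi m n).
Proof.
elim: n m z => //= n IH m z ht hb tz rz bz.
have /andP[h1 h2] : t m <= xi m <= t m.+1 by apply: ht; lia.
rewrite /piece_le/= tz rz bz h1 (le_trans h1 h2) eqxx/=.
by apply: IH => //=; [move=> i ?; apply: ht; lia|move=> i ?; apply: hb; lia
  |apply: hb; lia].
Qed.

Lemma piece_in_tagged_pieces (beta t xi : nat -> R) m n :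
  (forall i, (m <= i < m + n)%N -> t i <= xi i <= t i.+1) ->
  (forall i, (m <= i < m + n)%N ->
    [&& a <= beta i, beta i <= t i, t i.+1 <= beta i + d & t i.+1 <= b]) ->
  all (piece_in a b d) (tagged_pieces beta t xi m n).
Proof.
elim: n m => //= n IH m ht hb.
have /andP[h1 h2] : t m <= xi m <= t m.+1 by apply: ht; lia.
have /and4P[b1 b2 b3 b4] :
  [&& a <= beta m, beta m <= t m, t m.+1 <= beta m + d & t m.+1 <= b].
  by apply: hb; lia.
have h3 := le_trans h1 h2.
rewrite /piece_in/= b1 b2 lexx (le_trans h3 b4) (le_trans h3 b3) b3 b4 h2.
rewrite (le_trans b2 h1)/=.
by apply: IH => i ?; [apply: ht|apply: hb]; lia.
Qed.

(** * Left sums and refinements *)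

Fixpoint left_sum t (s : seq R) : V :=
  if s is u :: s' then f t (g u - g t) + left_sum u s' else 0.

Lemma left_sum_iota (t : nat -> R) u m n : t m = u ->
  left_sum u [seq t i.+1 | i <- iota m n] =
  \sum_(m <= i < m + n) f (t i) (g (t i.+1) - g (t i)).
Proof.
elim: n m u => [|n IH] m u /=; first by rewrite addn0 big_geq.
move=> <-; have mn : (m < m + n.+1)%N by lia.
by rewrite (IH _ _ erefl) big_ltn// addSnnS.
Qed.

(* [s] refines [p :: P]; the base of a piece is the last node of [p :: P] met
   so far, found by the greedy matching of [subseq]. *)
Fixpoint refine_pieces (p : R) (P : seq R) (x : R) (s : seq R) : seq (piece R) :=
  if s is y :: s' then
    Piece x y p ::
      (if P is p1 :: P' then
         if p1 == y then refine_pieces p1 P' y s' else refine_pieces p P y s'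
       else refine_pieces p P y s')
  else [::].

Lemma piece_sum_tag_refine (p x : R) (P s : seq R) :
  piece_sum (@tag R) x (refine_pieces p P x s) = left_sum x s.
Proof.
elim: s p x P => //= y s IH p x P; congr (_ + _).
by case: P => [|p1 P]; [|case: ifP => _]; rewrite IH.
Qed.

(** The pieces of base [p] telescope up to the next node. The induction needs a current point [x]
    that may differ from [p]; for [x = p] the value is the left sum over [P]. *)
Lemma piece_sum_base_refine (p x : R) (P s : seq R) :
  subseq P s -> last p P = last x s ->
  piece_sum (@base R) x (refine_pieces p P x s) =
  if P is p1 :: P' then f p (g p1 - g x) + left_sum p1 P' else f p (g p - g x).
Proof.
have step p' u v w : f p' (g u - g v) + f p' (g w - g u) = f p' (g w - g v).
  have -> : g w - g v = (g u - g v) + (g w - g u) by rewrite [RHS]addrC subrKA.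
  by rewrite [f _ (_ - _ + _)]linearD.
elim: s p x P => [|y s IH] p x P.
  by move/eqP => -> /= ->; rewrite subrr linear0.
case: P => [|p1 P] /=.
  by move=> _ e; rewrite IH ?sub0seq// step.
case: eqP => [->|_] sP e; rewrite IH//; last by rewrite addrA step.
by case: P {sP e} => //=; rewrite subrr linear0.
Qed.

Lemma path_refine_pieces z (p x : R) (P s : seq R) :
  path <=%R x s -> tag z <= x -> right z <= x -> (p == base z) || (x == p) ->
  path piece_le z (refine_pieces p P x s).
Proof.
elim: s p x P z => //= y s IH p x P z /andP[xy ys] tz rz pz.
rewrite /piece_le/= tz (le_trans rz xy) pz/=.
by case: P => [|p1 P]; [|case: ifP => [/eqP->|_]]; apply: IH; rewrite //= eqxx ?orbT.
Qed.

Lemma piece_in_refine_pieces (p x : R) (P s : seq R) : 0 <= d ->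
  path <=%R x s -> a <= p -> p <= x -> last x s <= b -> subseq P s ->
  path (fun u w => w <= u + d) p P -> last x s = last p P ->
  all (piece_in a b d) (refine_pieces p P x s).
Proof.
move=> d0; elim: s p x P => // y s IH p x P pxs ap px lb sP gP e.
have /= /andP[xy ys] := pxs.
have yl : y <= last y s.
  have := mem_last y s; rewrite inE => /predU1P[->//|ls].
  by move: ys; rewrite (path_sortedE le_trans) => /andP[/allP/(_ _ ls)].
(* The next node [p1] still occurs in [y :: s], so [y <= p1 <= p + d]; once [P] is exhausted, [p] is
   the last point of [s] and [y <= p]. *)
have yd : y <= p + d.
  case: P sP gP e => [|p1 P] sP gP e; first by rewrite /= in e; lra.
  case/andP: gP => p1d _; apply: le_trans p1d.
  have : p1 \in y :: s by apply: (mem_subseq sP); rewrite mem_head.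
  rewrite inE => /predU1P[->//|ps].
  by move: ys; rewrite (path_sortedE le_trans) => /andP[/allP/(_ _ ps)].
rewrite [all _ _]/= {1}/piece_in/= ap px xy (le_trans yl lb) yd/=.
case: P sP gP e => [|p1 P] /= sP gP e; first by apply: IH => //; [lra|exact: sub0seq].
case: eqP sP => [py|_] sP.
  by rewrite py in gP e *; case/andP: gP => _ gP; apply: IH => //; lra.
by apply: IH => //; lra.
Qed.

Lemma path_le_last (x y : R) (s : seq R) : path <=%R x s -> y \in x :: s -> y <= last x s.
Proof.
elim: s x y => [|u s IH] x y /=; first by rewrite inE => _ /eqP->.
case/andP=> xu us; rewrite inE => /predU1P[->|]; last exact: IH.
by rewrite (le_trans xu)// IH// mem_head.
Qed.

(** * Comparison of Riemann sums over tagged partitions *)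

Variable M : R.
Hypothesis cost_le : forall n, \sum_(1 <= k < n.+1) c k <= M.

Definition tp_nodes (P : tagged_partition a b) : seq R :=
  [seq tp_node P i.+1 | i <- iota 0 (tp_size P)].

Lemma tp_node_mono (P : tagged_partition a b) i j :
  (i <= j <= tp_size P)%N -> tp_node P i <= tp_node P j.
Proof.
case/andP => ij jn; elim: j ij jn => [|j IH]; first by rewrite leqn0 => /eqP->.
rewrite leq_eqVlt => /predU1P[->//|]; rewrite ltnS => ij jn.
by apply: le_trans (IH ij (ltnW jn)) _; exact/ltW/tp_node_lt.
Qed.

Lemma tp_node_in (P : tagged_partition a b) i : (i <= tp_size P)%N ->
  a <= tp_node P i <= b.
Proof.
move=> iP; have := tp_node_mono (P := P) (i := 0) (j := i).
have := tp_node_mono (P := P) (i := i) (j := tp_size P).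
by rewrite tp_node_first tp_node_last iP leqnn => -> // ->.
Qed.

Lemma tp_tag_between (P : tagged_partition a b) i : (0 <= i < 0 + tp_size P)%N ->
  tp_node P i <= tp_tag P i <= tp_node P i.+1.
Proof. by rewrite add0n /= => /tp_tag_in; rewrite in_itv. Qed.

Lemma tp_gap (P : tagged_partition a b) i : (i < tp_size P)%N ->
  tp_node P i.+1 - tp_node P i <= tp_mesh P.
Proof.
by move=> ip; apply: (@le_bigmax _ _ _ _ (fun i : 'I__ => _) (Ordinal ip)).
Qed.

(** With [a] as the only base, the sum over bases telescopes. *)
Lemma RS_sum_near_start (P : tagged_partition a b) : b <= a + d ->
  `|RS_sum f g P - f a (g b - g a)| <= M.
Proof.
move=> bd; pose s := tagged_pieces (fun=> a) (tp_node P) (tp_tag P) 0 (tp_size P).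
have := cost_le (mergeable root_piece s); apply: le_trans.
have ps : path piece_le root_piece s.
  apply: path_tagged_pieces; rewrite /= ?tp_node_first ?eqxx ?orbT//.
  exact: tp_tag_between.
have ins : all (piece_in a b d) s.
  apply: piece_in_tagged_pieces; first exact: tp_tag_between.
  move=> i iP; have iP' : (i < tp_size P)%N by lia.
  have /andP[a1 _] := tp_node_in (ltnW iP').
  have /andP[_ b1] := tp_node_in iP'.
  by rewrite lexx a1 b1 (le_trans b1 bd).
have := piece_sum_merging ps ins; rewrite /s.
rewrite (piece_sum_tagged_pieces (G := tp_tag P) _ (tp_node_first P)); last by left.
rewrite (piece_sum_tagged_pieces (G := fun=> a) _ (tp_node_first P)); last by right.
rewrite add0n (big_mkord xpredT) -[X in _ - X]raddf_sum telescope_sumr//.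
by rewrite tp_node_last tp_node_first.
Qed.

(** Here each interval takes its left node as base. *)
Lemma RS_sum_near_left_sum (P : tagged_partition a b) : tp_mesh P <= d ->
  `|RS_sum f g P - left_sum a (tp_nodes P)| <= M.
Proof.
move=> bd; pose s := tagged_pieces (tp_node P) (tp_node P) (tp_tag P) 0 (tp_size P).
have := cost_le (mergeable root_piece s); apply: le_trans.
have ps : path piece_le root_piece s.
  apply: path_tagged_pieces; rewrite /= ?tp_node_first ?eqxx ?orbT//.
    exact: tp_tag_between.
  by move=> i _; rewrite eqxx orbT.
have ins : all (piece_in a b d) s.
  apply: piece_in_tagged_pieces; first exact: tp_tag_between.
  move=> i iP; have iP' : (i < tp_size P)%N by lia.
  have /andP[a1 _] := tp_node_in (ltnW iP').
  have /andP[_ b1] := tp_node_in iP'.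
  by rewrite lexx a1 b1 -lerBlDl (le_trans (tp_gap iP') bd).
have := piece_sum_merging ps ins; rewrite /s.
rewrite (piece_sum_tagged_pieces (G := tp_tag P) _ (tp_node_first P)); last by left.
rewrite (piece_sum_tagged_pieces (G := tp_node P) _ (tp_node_first P)); last by right.
rewrite /tp_nodes (left_sum_iota _ (tp_node_first P)).
by rewrite add0n !(big_mkord xpredT).
Qed.

(** For one and the same list of pieces, the finer left sum is the sum over tags and the coarser one
    the sum over bases. *)
Lemma left_sum_refine (P s : seq R) : 0 <= d ->
  path <=%R a s -> subseq P s -> last a s = b -> last a P = b ->
  path (fun u w => w <= u + d) a P ->
  `|left_sum a s - left_sum a P| <= M.
Proof.
move=> d0 ps sP sb Pb gP.
have := cost_le (mergeable root_piece (refine_pieces a P a s)); apply: le_trans.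
have := @piece_sum_merging (refine_pieces a P a s).
rewrite piece_sum_tag_refine piece_sum_base_refine ?sb ?Pb//.
have -> : (if P is p1 :: P' then f a (g p1 - g a) + left_sum p1 P'
    else f a (g a - g a)) = left_sum a P.
  by case: P {sP Pb gP} => //=; rewrite subrr linear0.
apply; first by apply: path_refine_pieces; rewrite /= ?eqxx ?orbT.
by apply: piece_in_refine_pieces; rewrite ?sb ?Pb.
Qed.

Lemma path_iota (t : nat -> R) (r : rel R) u m n : t m = u ->
  (forall i, (m <= i < m + n)%N -> r (t i) (t i.+1)) ->
  path r u [seq t i.+1 | i <- iota m n].
Proof.
elim: n m u => //= n IH m u <- H; rewrite H ?(IH m.+1)//; last by lia.
by move=> i ?; apply: H; lia.
Qed.

Lemma tp_nodes_path (P : tagged_partition a b) (r : rel R) :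
  (forall i, (i < tp_size P)%N -> r (tp_node P i) (tp_node P i.+1)) ->
  path r a (tp_nodes P).
Proof.
by move=> H; apply: path_iota => [|i]; [exact: tp_node_first|exact: H].
Qed.

Lemma last_tp_nodes (P : tagged_partition a b) : last a (tp_nodes P) = b.
Proof.
rewrite -[RHS](tp_node_last P) /tp_nodes.
case: (tp_size P) => [|n]; first by rewrite tp_node_first.
by rewrite -[n.+1]addn1 iotaD map_cat last_cat /= add0n addn1.
Qed.

Lemma RS_sum_close (P Q : tagged_partition a b) : 0 <= d ->
  tp_mesh P <= d -> tp_mesh Q <= d -> `|RS_sum f g P - RS_sum f g Q| <= 4 * M.
Proof.
(* Nodes common to [P] and [Q] occur twice in [s]; this is harmless, as all chains are weakly
   increasing. *)
move=> d0 Pd Qd; set s := sort <=%R (tp_nodes P ++ tp_nodes Q).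
have sortedN (S : tagged_partition a b) : path <=%R a (tp_nodes S).
  by apply: tp_nodes_path => i iS; exact/ltW/tp_node_lt.
have gapN (S : tagged_partition a b) : tp_mesh S <= d ->
    path (fun u w => w <= u + d) a (tp_nodes S).
  by move=> Sd; apply: tp_nodes_path => i iS; rewrite -lerBlDl (le_trans (tp_gap iS)).
have boundN (S : tagged_partition a b) (w : R) : w \in tp_nodes S -> a <= w <= b.
  by case/mapP => i; rewrite mem_iota add0n /= => iS ->; exact: tp_node_in.
have ps : path <=%R a s.
  rewrite (path_sortedE le_trans) sort_le_sorted andbT; apply/allP => x.
  by rewrite mem_sort mem_cat => /orP[] /boundN/andP[].
have sub (S : tagged_partition a b) : subseq (tp_nodes S) (tp_nodes P ++ tp_nodes Q) ->
    subseq (tp_nodes S) s.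
  move=> sS; apply: sorted_subseq_sort => //; [exact: le_total|exact: le_trans|].
  exact: path_sorted (sortedN S).
have subP := sub P (prefix_subseq _ _); have subQ := sub Q (suffix_subseq _ _).
have sb : last a s = b.
  apply/eqP; rewrite eq_le; apply/andP; split.
    have := mem_last a s; rewrite inE => /predU1P[->//|].
    by rewrite mem_sort mem_cat => /orP[] /boundN/andP[].
  have : b \in a :: s.
    have := mem_last a (tp_nodes P); rewrite last_tp_nodes !inE.
    by case/predU1P => [->|/(mem_subseq subP) ->]; rewrite ?eqxx ?orbT.
  exact: path_le_last.
have [hP hQ] := (RS_sum_near_left_sum Pd, RS_sum_near_left_sum Qd).
have := left_sum_refine d0 ps subP sb (last_tp_nodes P) (gapN P Pd).
have := left_sum_refine d0 ps subQ sb (last_tp_nodes Q) (gapN Q Qd).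
set A := RS_sum f g P in hP *; set B := RS_sum f g Q in hQ *.
set A' := left_sum a (tp_nodes P) in hP *; set B' := left_sum a (tp_nodes Q) in hQ *.
set L := left_sum a s => hB hA.
have -> : A - B = (A - A') + (A' - L) + (L - B') + (B' - B).
  by rewrite !subrKA.
rewrite distrC in hA; rewrite distrC in hQ.
rewrite (le_trans (ler_normD _ _))// (_ : 4 * M = M + M + M + M); last by ring.
rewrite lerD// (le_trans (ler_normD _ _))// lerD// (le_trans (ler_normD _ _))//.
by rewrite lerD.
Qed.

End merging.

(** * Sums of powers, with and without a cap *)

Section power_sums.
Context {R : realType}.
Implicit Types (r alpha beta A omega t : R) (k m n : nat).

Lemma powR_le_expR t r : 0 <= t -> 0 <= r -> t `^ r <= expR (r * (t - 1)).
Proof.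
move=> t0 r0; rewrite mulrC expRM ge0_ler_powR ?nnegrE ?expR_ge0//.
by have := expR_ge1Dx (t - 1); rewrite addrC subrK.
Qed.

Lemma pred_powR k r : (0 < k)%N ->
  k.-1%:R `^ r = k%:R `^ r * (1 - k%:R^-1) `^ r :> R.
Proof.
case: k => // k _; rewrite -powRM ?ler0n// ?subr_ge0 ?invf_le1 ?ler1n ?ltr0n//.
by rewrite mulrBr mulr1 divff ?pnatr_eq0// -natr1 addrK.
Qed.

(** With [x = 1 / k] and [c = 1 - beta], division by [k ^ c] leaves
    [x <= 2 / c * (1 - (1 - x) ^ c)]. This follows from [(1 - x) ^ c <= exp (- c * x) <= 1 / (1 + c
    * x)]; the factor 2 absorbs [1 + c * x <= 2]. *)
Lemma powR_telescope_pos k beta : (0 < k)%N -> 0 <= beta < 1 ->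
  k%:R `^ (- beta) <=
  2 / (1 - beta) * (k%:R `^ (1 - beta) - k.-1%:R `^ (1 - beta)).
Proof.
move=> k0 /andP[b0 b1]; set c := 1 - beta; have c0 : 0 < c by rewrite subr_gt0.
have kR0 : 0 < k%:R :> R by rewrite ltr0n.
have x1 : k%:R^-1 <= 1 :> R by rewrite invf_le1 ?ler1n.
rewrite pred_powR// -[X in X - _]mulr1 -mulrBr.
have -> : k%:R `^ (- beta) = k%:R `^ c * k%:R^-1.
  rewrite -[X in _ = _ * X]powR_inv1 ?ltW// -powRD ?(gt_eqF kR0) ?implybT//.
  by congr (_ `^ _); rewrite /c; ring.
rewrite mulrCA ler_wpM2l ?powR_ge0//.
have x0 : 0 < k%:R^-1 :> R by rewrite invr_gt0.
set x := k%:R^-1 in x0 x1 *.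
have h : (1 - x) `^ c <= (1 + c * x)^-1.
  apply: le_trans (powR_le_expR _ (ltW c0)) _; first by rewrite subr_ge0.
  have -> : c * (1 - x - 1) = - (c * x) by ring.
  rewrite expRN lef_pV2 ?posrE ?expR_gt0 ?expR_ge1Dx//.
  by rewrite ltr_wpDr// mulr_ge0// ltW.
apply: (@le_trans _ _ (2 / c * (1 - (1 + c * x)^-1))); last first.
  by rewrite ler_wpM2l ?lerB// divr_ge0// ltW.
have y0 : 0 < c * x by exact: mulr_gt0.
have y1 : c * x <= 1.
  by rewrite mulr_ile1 ?(ltW c0) ?(ltW x0)// /c; lra.
have -> : 2 / c * (1 - (1 + c * x)^-1) = 2 * x / (1 + c * x).
  by field; rewrite (gt_eqF c0) andbT gt_eqF//; lra.
have y2 : 0 < 1 + c * x by lra.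
rewrite ler_pdivlMr//.
by rewrite [2 * x]mulrC ler_wpM2l ?(ltW x0)//; lra.
Qed.

(** With [x = 1 / k < 1] this reduces to [1 + r * x <= exp (r * x) <= (1 - x) ^ (- r)]. *)
Lemma powR_telescope_neg k r : (1 < k)%N -> 0 < r ->
  k%:R `^ (- (1 + r)) <= r^-1 * (k.-1%:R `^ (- r) - k%:R `^ (- r)).
Proof.
move=> k1 r0; have kR0 : 0 < k%:R :> R by rewrite ltr0n; lia.
rewrite pred_powR; last by lia.
rewrite -[X in _ - X]mulr1 -mulrBr.
have -> : k%:R `^ (- (1 + r)) = k%:R `^ (- r) * k%:R^-1.
  rewrite -[X in _ = _ * X]powR_inv1 ?ltW// -powRD ?(gt_eqF kR0) ?implybT//.
  by congr (_ `^ _); ring.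
rewrite mulrCA ler_wpM2l ?powR_ge0// ler_pdivlMl// lerBrDl.
have x0 : 0 < k%:R^-1 :> R by rewrite invr_gt0.
have x1 : k%:R^-1 < 1 :> R by rewrite invf_lt1 ?ltr1n.
set x := k%:R^-1 in x0 x1 *.
rewrite powRN; apply: le_trans (expR_ge1Dx _) _.
have -> : r * x = - (r * (1 - x - 1)) by ring.
rewrite expRN lef_pV2 ?posrE ?expR_gt0 ?powR_gt0//; last by lra.
by apply: powR_le_expR; [lra|exact: ltW].
Qed.

Lemma sum_powR_head n beta : 0 <= beta < 1 ->
  \sum_(1 <= k < n.+1) k%:R `^ (- beta) <= 2 / (1 - beta) * n%:R `^ (1 - beta).
Proof.
move=> b01; have b1 : 1 - beta != 0 by case/andP: b01 => _ h; rewrite gt_eqF//; lra.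
elim: n => [|n IH]; first by rewrite big_geq// powR0// mulr0.
rewrite big_nat_recr//=.
have := @powR_telescope_pos n.+1 beta isT b01.
by rewrite mulrBr /=; lra.
Qed.

Lemma sum_powR_tail m n r : (0 < m)%N -> 0 < r ->
  \sum_(m.+1 <= k < n) k%:R `^ (- (1 + r)) <= r^-1 * m%:R `^ (- r).
Proof.
move=> m0 r0; have [nm|mn] := leqP n m.+1.
  by rewrite big_geq// mulr_ge0 ?powR_ge0// invr_ge0 ltW.
suff H : \sum_(m.+1 <= k < n) k%:R `^ (- (1 + r))
    <= r^-1 * (m%:R `^ (- r) - n.-1%:R `^ (- r)).
  apply: le_trans H _; rewrite ler_wpM2l ?invr_ge0 ?(ltW r0)//.
  by rewrite lerBlDr lerDl powR_ge0.
move/ltnW: mn.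
elim: n => // n IH; rewrite ltnS leq_eqVlt => /predU1P[<-|mn].
  by rewrite big_geq//= subrr mulr0.
rewrite big_nat_recr//=.
have n1 : (1 < n)%N by lia.
have := powR_telescope_neg n1 r0; have := IH mn.
by rewrite !mulrBr; lra.
Qed.

(** For an arbitrary cut-off [m], the minimum is bounded by [omega] up to [m] and by the power
    beyond it. *)
Lemma sum_min_powR alpha beta A omega m n :
  0 <= beta < 1 -> 1 < alpha + beta -> 0 <= A -> 0 <= omega -> (0 < m)%N ->
  \sum_(1 <= k < n.+1) Num.min omega (A * k%:R `^ (- alpha)) * k%:R `^ (- beta)
  <= 2 / (1 - beta) * omega * m%:R `^ (1 - beta)
     + (alpha + beta - 1)^-1 * A * m%:R `^ (- (alpha + beta - 1)).
Proof.
move=> b01 ab1 A0 o0 m0; set r := alpha + beta - 1.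
have r0 : 0 < r by rewrite subr_gt0.
have /andP[b0 b1] := b01.
have head N : \sum_(1 <= k < N.+1)
    Num.min omega (A * k%:R `^ (- alpha)) * k%:R `^ (- beta)
    <= 2 / (1 - beta) * omega * N%:R `^ (1 - beta).
  rewrite mulrAC mulrC; apply: le_trans (ler_wpM2l o0 (sum_powR_head N b01)).
  rewrite mulr_sumr; apply: ler_sum => k _.
  by rewrite ler_wpM2r ?powR_ge0// ge_min lexx.
have tail0 : 0 <= r^-1 * A * m%:R `^ (- r).
  by rewrite !mulr_ge0 ?powR_ge0// invr_ge0 ltW.
have [nm|mn] := leqP n m.
  apply: le_trans (head n) _; apply: (@le_trans _ _
    (2 / (1 - beta) * omega * m%:R `^ (1 - beta))); last by rewrite lerDl.
  rewrite ler_wpM2l//; first by rewrite mulr_ge0// divr_ge0//; lra.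
  by rewrite ge0_ler_powR ?nnegrE ?ler_nat//; lra.
rewrite (@big_cat_nat _ _ _ m.+1)//=; last by rewrite ltnS ltnW.
apply: lerD; first exact: head.
rewrite mulrAC mulrC; apply: le_trans (ler_wpM2l A0 (sum_powR_tail n.+1 m0 r0)).
rewrite mulr_sumr; apply: ler_sum_nat => k /andP[mk _].
have kR0 : k%:R != 0 :> R by rewrite pnatr_eq0; lia.
have -> : k%:R `^ (- (1 + r)) = k%:R `^ (- alpha) * k%:R `^ (- beta).
  by rewrite -powRD ?kR0 ?implybT//; congr (_ `^ _); rewrite /r; ring.
by rewrite mulrA ler_wpM2r ?powR_ge0// ge_min lexx orbT.
Qed.

(* The cut-off [m] is taken at the index where [A * m^-alpha] falls below
   [omega]. *)
Lemma sum_min_powR_balanced alpha beta A omega n :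
  0 < alpha -> 0 <= beta < 1 -> 1 < alpha + beta -> 0 <= omega <= A ->
  \sum_(1 <= k < n.+1) Num.min omega (A * k%:R `^ (- alpha)) * k%:R `^ (- beta)
  <= (2 / (1 - beta) + 2 `^ (alpha + beta - 1) / (alpha + beta - 1))
     * (A `^ ((1 - beta) / alpha) * omega `^ (1 - (1 - beta) / alpha)).
Proof.
move=> al0 b01 ab1 /andP[o0 oA]; have A0 := le_trans o0 oA.
have /andP[b0 b1] := b01; set r := alpha + beta - 1.
have r0 : 0 < r by rewrite subr_gt0.
(* The case [omega = 0], where all terms vanish, is set apart because [tau] divides by [omega]. *)
move: o0; rewrite le_eqVlt => /predU1P[o0|o0].
  apply: (@le_trans _ _ 0); last first.
    by rewrite mulr_ge0 ?mulr_ge0 ?powR_ge0// addr_ge0// divr_ge0 ?powR_ge0//; lra.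
  rewrite big_nat; apply: sumr_le0 => k _.
  by rewrite -o0 min_l ?mul0r// mulr_ge0// powR_ge0.
pose tau := (A / omega) `^ alpha^-1.
have Ao : 1 <= A / omega by rewrite ler_pdivlMr// mul1r.
have tau1 : 1 <= tau.
  have e : 1 `^ alpha^-1 = 1 :> R by rewrite powR1.
  by rewrite -e ge0_ler_powR ?nnegrE ?invr_ge0 ?(ltW al0)//; lra.
have tau0 : 0 <= tau by lra.
have := truncn_itv tau0; set m := Num.truncn tau => /andP[mt tm].
have m0 : (0 < m)%N by rewrite truncn_ge_nat.
apply: le_trans (sum_min_powR n b01 ab1 A0 (ltW o0) m0) _.
set kappa := (1 - beta) / alpha.
have key : A `^ kappa * omega `^ (1 - kappa) = omega * (A / omega) `^ kappa.
  rewrite powRM// ?invr_ge0 ?(ltW o0)// powRD ?(gt_eqF o0) ?implybT//.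
  rewrite powRr1 ?(ltW o0)// powRN -(powR_inv1 (ltW o0)).
  rewrite -[in RHS]powRrM mulrC mulN1r powRN.
  ring.
rewrite key [leRHS]mulrDl; apply: lerD.
  rewrite -mulrA ler_wpM2l//; first by rewrite divr_ge0//; lra.
  rewrite ler_wpM2l ?(ltW o0)//.
  have -> : (A / omega) `^ kappa = tau `^ (1 - beta).
    by rewrite -powRrM; congr (_ `^ _); rewrite /kappa mulrC.
  by rewrite ge0_ler_powR ?nnegrE//; lra.
rewrite -/r; have -> : 2 `^ r / r * (omega * (A / omega) `^ kappa) =
    r^-1 * A * (2 `^ r * (A / omega) `^ (kappa - 1)).
  have Ao0 : A / omega != 0 by rewrite gt_eqF//; lra.
  have -> : (A / omega) `^ (kappa - 1) = (A / omega) `^ kappa / (A / omega).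
    by rewrite powRB ?Ao0 ?implybT// powRr1//; lra.
  by field; rewrite !gt_eqF//; lra.
rewrite ler_wpM2l//; first by rewrite mulr_ge0// invr_ge0 ltW.
have -> : (A / omega) `^ (kappa - 1) = tau `^ (- r).
  by rewrite -powRrM; congr (_ `^ _); rewrite /kappa /r; field; rewrite gt_eqF.
rewrite !powRN -[2 `^ r]invrK -invfM.
have p2 : 0 < (2 : R) `^ r by exact: powR_gt0.
have pt : 0 < tau `^ r by apply: powR_gt0; lra.
have pm : 0 < (m%:R : R) `^ r by apply: powR_gt0; rewrite ltr0n.
rewrite lef_pV2 ?posrE ?mulr_gt0 ?invr_gt0// ler_pdivrMl// -powRM ?ler0n//.
rewrite ge0_ler_powR ?nnegrE ?(ltW r0) ?mulr_ge0 ?ler0n//.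
(* Hence [tau < m + 1 <= 2 * m], the origin of the factor [2 ^ r]. *)
have m1 : 1 <= m%:R :> R by rewrite ler1n.
by move: tm; rewrite -natr1; lra.
Qed.

End power_sums.

(** * Increments of functions of finite p-TV norm *)

Section increments.
Context {R : realType} {W : normedModType R}.
Implicit Types (h : R -> W) (a b p t x : R) (s : seq R).

(** Finitely many strict inequalities survive a small increase of [x]. This replaces a threshold
    that may be 0 by a positive one, as [jumps_bound] demands. *)
Lemma jumps_right_continuous h x t s :
  exists2 y, x < y & forall z, z < y -> (jumps x h t s <= jumps z h t s)%N.
Proof.
elim: s t => [|u s IH] t /=; first by exists (x + 1) => //; rewrite ltrDl.
have [y xy Hy] := IH u; have [xu|ux] := ltP x `|h u - h t|.
  exists (Num.min y `|h u - h t|); first by rewrite lt_min xy.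
  by move=> z; rewrite lt_min => /andP[/Hy zy ->]; rewrite leq_add2l.
by exists y => // z /Hy H; exact: leq_trans H (leq_addl _ _).
Qed.

(** The factor [3 ^ (1 / p)] turns the weak-type bound at threshold [jump_size * k ^ (- 1 / p)] into
    at most [k / 3] jumps. *)
Definition jump_size p h a b : R := 2 * 3 `^ p^-1 * fine (pTV_norm p h a b).

Lemma few_jumps_pTV p h a b k t s : 1 < p -> a <= b -> Up p a b h -> (0 < k)%N ->
  a <= t -> path <=%R t s -> last t s <= b ->
  (3 * jumps (jump_size p h a b * k%:R `^ (- p^-1)) h t s <= k)%N.
Proof.
move=> p1 ab hU k0 at_ ts sb; set x := _ * _.
have [_ A0] := pTV_norm_fin_num ab hU; set A := fine _ in A0.
have p0 : 0 < p by rewrite (lt_trans ltr01).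
have kR : 0 < k%:R :> R by rewrite ltr0n.
have x0 : 0 <= x by rewrite !mulr_ge0 ?powR_ge0.
have [y xy Hy] := jumps_right_continuous h x t s.
have [z /andP[xz zy]] : exists z, x < z < y by exists ((x + y) / 2); rewrite !midf_lt.
have z0 := le_lt_trans x0 xz.
have := jumps_bound p1 hU z0 at_ ts sb; rewrite -/A => zA.
have xp : x `^ p = 3 / k%:R * (2 * A) `^ p.
  have -> : x = (3 / k%:R) `^ p^-1 * (2 * A).
    have kV : k%:R^-1 `^ p^-1 = k%:R `^ (- p^-1) :> R.
      by rewrite -powR_inv1 ?ler0n// -powRrM mulN1r.
    by rewrite /x /jump_size powRM ?invr_ge0 ?ler0n// kV -/A; ring.
  by rewrite powRM ?powR_ge0 ?mulr_ge0// -powRrM mulVf ?gt_eqF// powRr1.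
have zp : x `^ p < z `^ p by rewrite gt0_ltr_powR ?nnegrE// ltW.
have zp0 : 0 < z `^ p by exact: powR_gt0.
apply: leq_trans (leq_mul (leqnn 3) (Hy z zy)) _.
rewrite -(ler_nat R) natrM -(ler_pM2r zp0) -mulrA.
apply: (@le_trans _ _ (3 * (2 * A) `^ p)); first by rewrite ler_wpM2l.
have -> : 3 * (2 * A) `^ p = k%:R * x `^ p by rewrite xp; field; rewrite gt_eqF.
by rewrite ler_wpM2l// ltW.
Qed.

(** A larger increment would be a one-step chain with one jump above some [z > 2 * A], against
    [jumps_bound]. *)
Lemma increment_le p h a b t u : 1 < p -> Up p a b h ->
  a <= t -> t <= u -> u <= b ->
  `|h u - h t| <= 2 * fine (pTV_norm p h a b).
Proof.
move=> p1 hU at_ tu ub; have ab := le_trans at_ (le_trans tu ub).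
have [_ A0] := pTV_norm_fin_num ab hU; set A := fine _ in A0 *.
rewrite leNgt; apply/negP => lt.
have [z /andP[xz zy]] : exists z, 2 * A < z < `|h u - h t|.
  by exists ((2 * A + `|h u - h t|) / 2); rewrite !midf_lt.
have z0 : 0 < z by apply: le_lt_trans xz; rewrite mulr_ge0.
have := @jumps_bound _ _ p h a b t [:: u] z p1 hU z0 at_.
rewrite /= tu zy mul1r => /(_ isT ub); apply/negP; rewrite -ltNge -/A.
by rewrite gt0_ltr_powR ?nnegrE ?mulr_ge0 ?(ltW z0)// (lt_trans ltr01).
Qed.

Lemma osc_norm_fin_num p h a b : 1 < p -> a < b -> Up p a b h ->
  osc_norm h a b = (fine (osc_norm h a b))%:E /\
  0 <= fine (osc_norm h a b) <= 2 * fine (pTV_norm p h a b).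
Proof.
move=> p1 ab hU.
have o0 : (0 <= osc_norm h a b)%E.
  apply: (@le_trans _ _ `|h a - h b|%:E); first by rewrite lee_fin.
  by apply: ereal_sup_ubound; exists a, b.
have oA : (osc_norm h a b <= (2 * fine (pTV_norm p h a b))%:E)%E.
  apply: ge_ereal_sup => _ [s [t [as_ st tb ->]]].
  by rewrite lee_fin distrC increment_le// ltW.
have of_ : osc_norm h a b \is a fin_num.
  by rewrite ge0_fin_numE// (le_lt_trans oA)// ltry.
by rewrite fineK// fine_ge0//= -lee_fin fineK.
Qed.

Lemma increment_le_osc p h a b t u : 1 < p -> a < b -> Up p a b h ->
  a <= t -> t <= u -> u <= b -> `|h u - h t| <= fine (osc_norm h a b).
Proof.
move=> p1 ab hU at_ tu ub; have [oE /andP[o0 _]] := osc_norm_fin_num p1 ab hU.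
move: tu; rewrite le_eqVlt => /predU1P[->|tu]; first by rewrite subrr normr0.
rewrite -lee_fin -oE distrC; apply: ereal_sup_ubound.
by exists t, u.
Qed.

Lemma continuous_in_at_small h a b t e : continuous_in_at h a b t -> 0 < e ->
  a <= t <= b ->
  exists2 r, 0 < r & forall x y, a <= x <= b -> a <= y <= b ->
    `|x - t| < r -> `|y - t| < r -> `|h y - h x| <= e.
Proof.
move=> ct e0 tab.
have /cvgrPdist_lt/(_ _ (divr_gt0 e0 (ltr0n _ 2))) := ct.
rewrite near_withinE => /nbhs_ballP[r /= r0 hr]; exists r => // x y xab yab xr yr.
have hx : `|h t - h x| < e / 2.
  by apply: hr; rewrite /= ?in_itv//= -ball_normE /= distrC.
have hy : `|h t - h y| < e / 2.
  by apply: hr; rewrite /= ?in_itv//= -ball_normE /= distrC.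
rewrite -(subrKA (h t)) (le_trans (ler_normD _ _))// distrC.
by move: hx hy; lra.
Qed.

End increments.

(** Near each point one of the two functions is continuous, so its increments are small, while those
    of the other are bounded; compactness of [a, b] makes the radius uniform. *)
Lemma no_common_discontinuity_small {R : realType} {W W' : normedModType R}
    (f : R -> W) (g : R -> W') (a b Mf Mg e : R) :
  (forall x y, a <= x <= b -> a <= y <= b -> `|f y - f x| <= Mf) ->
  (forall x y, a <= x <= b -> a <= y <= b -> `|g y - g x| <= Mg) ->
  no_common_discontinuity f g a b -> 0 < e ->
  exists2 d, 0 < d & forall v x y u w, a <= v <= b ->
    a <= x <= b -> a <= y <= b -> a <= u <= b -> a <= w <= b ->
    `|x - v| <= d -> `|y - v| <= d -> `|u - v| <= d -> `|w - v| <= d ->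
    `|f y - f x| * `|g w - g u| <= e.
Proof.
move=> fM gM fg e0.
pose P (d v : R) := forall x y u w,
    a <= x <= b -> a <= y <= b -> a <= u <= b -> a <= w <= b ->
    `|x - v| <= d -> `|y - v| <= d -> `|u - v| <= d -> `|w - v| <= d ->
    `|f y - f x| * `|g w - g u| <= e.
have : \forall d \near 0^'+, `[a, b]%classic `<=` P d.
  apply: (compact_near_coveringP _).1; first exact: segment_compact.
  move=> v /=; rewrite in_itv/= => vab.
  have M0f : 0 <= Mf by apply: le_trans (fM _ _ vab vab).
  have M0g : 0 <= Mg by apply: le_trans (gM _ _ vab vab).
  have [r r0 Hr] : exists2 r, 0 < r & forall x y u w,
      a <= x <= b -> a <= y <= b -> a <= u <= b -> a <= w <= b ->
      `|x - v| < r -> `|y - v| < r -> `|u - v| < r -> `|w - v| < r ->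
      `|f y - f x| * `|g w - g u| <= e.
    have [cf|cf] := pselect (continuous_in_at f a b v).
      have M1 : 0 < Mg + 1 by lra.
      have [r r0 Hr] := continuous_in_at_small cf (divr_gt0 e0 M1) vab.
      exists r => // x y u w xa ya ua wa xr yr _ _.
      apply: (@le_trans _ _ (e / (Mg + 1) * (Mg + 1))); last by rewrite divfK ?gt_eqF.
      apply: ler_pM => //; first exact: Hr.
      by apply: le_trans (gM _ _ ua wa) _; lra.
    have cg : continuous_in_at g a b v.
      by apply: contrapT => cg; apply: (fg v) => //; rewrite in_itv.
    have M1 : 0 < Mf + 1 by lra.
    have [r r0 Hr] := continuous_in_at_small cg (divr_gt0 e0 M1) vab.
    exists r => // x y u w xa ya ua wa _ _ ur wr.
    apply: (@le_trans _ _ ((Mf + 1) * (e / (Mf + 1)))).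
      apply: ler_pM => //; last exact: Hr.
      by apply: le_trans (fM _ _ xa ya) _; lra.
    by rewrite mulrC divfK ?gt_eqF.
  (* Half the radius goes to the distance from [v] to a nearby centre [v'], half to the distance
     from [v'] to the four points. *)
  have r2 : 0 < r / 2 by rewrite divr_gt0.
  exists (ball v (r / 2), [set d | d < r / 2]).
    by split => /=; [exact: nbhsx_ballx|exact: nbhs_right_lt].
  move=> [v' d] /= [] + dr x y u w xa ya ua wa.
  rewrite -ball_normE /= => vv.
  have tri z : `|z - v'| <= d -> `|z - v| < r.
    move=> zd; rewrite -(subrKA v') (le_lt_trans (ler_normD _ _))//.
    by rewrite distrC in vv; move: vv zd dr; lra.
  by move=> /tri xr /tri yr /tri ur /tri wr; exact: Hr.
move=> H; near (0 : R)^'+ => d.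
exists d => //.
move=> v x y u w va; have : `[a, b]%classic `<=` P d by near: d.
by move/(_ v); apply; rewrite /= in_itv.
Unshelve. all: by end_near. Qed.

(** * The estimate and the Cauchy property for Riemann sums *)

Section integral.
Context {R : realType} {E V : normedModType R}.
Variables (p q a b : R) (f : R -> contlin E V) (g : R -> E).
Hypotheses (p1 : 1 < p) (q1 : 1 < q) (pq : 1 < p^-1 + q^-1) (ab : a < b).
Hypotheses (fU : Up p a b f) (gU : Up q a b g).

Let A := jump_size p f a b.
Let B := jump_size q g a b.
Let X k := A * k%:R `^ (- p^-1).
Let Y k := B * k%:R `^ (- q^-1).

Let A0 : 0 <= A.
Proof.
by rewrite /A !mulr_ge0 ?powR_ge0//; have [] := pTV_norm_fin_num (ltW ab) fU.
Qed.

Let B0 : 0 <= B.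
Proof.
by rewrite /B !mulr_ge0 ?powR_ge0//; have [] := pTV_norm_fin_num (ltW ab) gU.
Qed.

Let few_jumps k t t' (s s' : seq R) : (0 < k)%N ->
  a <= t -> path <=%R t s -> last t s <= b ->
  a <= t' -> path <=%R t' s' -> last t' s' <= b ->
  (jumps (X k) f t s + jumps (Y k) g t' s' < k)%N.
Proof.
move=> k0 at_ ts sb at_' ts' sb'.
(* At most a third of [k] for each function gives at most two thirds in all, which is below [k] as
   [0 < k]. *)
have thirds i j : (3 * i <= k -> 3 * j <= k -> i + j < k)%N by clear -k0; lia.
apply: thirds; first exact: (few_jumps_pTV p1 (ltW ab) fU k0 at_ ts sb).
exact: (few_jumps_pTV q1 (ltW ab) gU k0 at_' ts' sb').
Qed.

Let qV01 : 0 <= q^-1 < 1.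
Proof.
have q0 := lt_trans ltr01 q1.
by rewrite invr_ge0 (ltW q0) invf_lt1.
Qed.

(** The bracket is the constant of [sum_min_powR_balanced] at [alpha = 1 / p], [beta = 1 / q]; the
    outer factors are the numerical parts of [B] and of [A ^ (p - p / q)]. *)
Definition young_const : R :=
  2 * 3 `^ q^-1 * (2 / (1 - q^-1) + 2 `^ (p^-1 + q^-1 - 1) / (p^-1 + q^-1 - 1))
  * (2 * 3 `^ p^-1) `^ (p - p / q).

(** Everything is merged into the base [a], the [k]-th cost being [X k] capped by the oscillation,
    times [Y k]. The exponents are those of the balanced sum:
    [(1 - 1 / q) / (1 / p) = p - p / q]. *)
Lemma RS_sum_young (P : tagged_partition a b) :
  `|RS_sum f g P - f a (g b - g a)| <=
  young_const * fine (pTV_norm p f a b) `^ (p - p / q)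
  * fine (osc_norm f a b) `^ (1 + p / q - p) * fine (pTV_norm q g a b).
Proof.
set F := fine (pTV_norm p f a b); set G := fine (pTV_norm q g a b).
set omega := fine (osc_norm f a b).
have [_ F0] := pTV_norm_fin_num (ltW ab) fU; rewrite -/F in F0.
have [_ /andP[o0 oF]] := osc_norm_fin_num p1 ab fU; rewrite -/F -/omega in o0 oF.
have p0 : 0 < p by rewrite (lt_trans ltr01).
have pV0 : 0 < p^-1 by rewrite invr_gt0.
have AE : A = 2 * 3 `^ p^-1 * F by [].
have oA : 0 <= omega <= A.
  rewrite o0 AE mulrAC; apply: le_trans oF _.
  rewrite ler_peMr ?mulr_ge0//.
  have e : 1 = 1 `^ p^-1 :> R by rewrite powR1.
  by rewrite [leLHS]e ge0_ler_powR ?nnegrE ?(ltW pV0)//; lra.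
pose c k := Num.min omega (X k) * Y k.
pose K := (2 / (1 - q^-1) + 2 `^ (p^-1 + q^-1 - 1) / (p^-1 + q^-1 - 1))
   * (A `^ ((1 - q^-1) / p^-1) * omega `^ (1 - (1 - q^-1) / p^-1)).
have cost n : \sum_(1 <= k < n.+1) c k <= B * K.
  apply: le_trans (ler_wpM2l B0 (sum_min_powR_balanced n pV0 qV01 pq oA)).
  rewrite mulr_sumr le_eqVlt; apply/orP; left; apply/eqP.
  by apply: eq_bigr => k _; rewrite /c /Y /X mulrCA.
have merge_le k v x x' u u' : (0 < k)%N ->
    a <= v -> v <= x -> x <= x' -> x' <= v + (b - a) -> x' <= b ->
    v <= u -> u <= u' -> u' <= v + (b - a) -> u' <= b ->
    `|f x' - f x| <= X k -> `|g u' - g u| <= Y k ->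
    `|f x' - f x| * `|g u' - g u| <= c k.
  move=> _ av vx xx' _ x'b _ _ _ _ fX gY; apply: ler_pM => //.
  by rewrite le_min fX andbT (increment_le_osc p1)// (le_trans av vx).
have := RS_sum_near_start (ltW ab) few_jumps merge_le cost P.
move=> /(_ _)/le_trans; apply; first by rewrite addrC subrK.
have -> : p - p / q = (1 - q^-1) / p^-1 by rewrite invrK; ring.
have -> : 1 + p / q - p = 1 - (1 - q^-1) / p^-1 by rewrite invrK; ring.
rewrite /K /young_const -/F -/G /B /jump_size -/G AE.
have -> : (1 - q^-1) / p^-1 = p - p / q by rewrite invrK; ring.
rewrite [(2 * 3 `^ p^-1 * F) `^ _]powRM ?mulr_ge0 ?powR_ge0//.
by rewrite le_eqVlt; apply/orP; left; apply/eqP; ring.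
Qed.

Lemma RS_sum_cauchy (e : R) : no_common_discontinuity f g a b -> 0 < e ->
  exists2 d, 0 < d & forall P Q : tagged_partition a b,
    tp_mesh P <= d -> tp_mesh Q <= d -> `|RS_sum f g P - RS_sum f g Q| <= e.
Proof.
move=> fg e0; pose r := p^-1 + q^-1 - 1.
have r0 : 0 < r by rewrite subr_gt0.
have AB0 : 0 <= A * B by exact: mulr_ge0.
(* [T <= m ^ r] brings the sum beyond [m] below [e / 8]; [eps] is then chosen so that the bound
   [2 * eps * m] on the head equals [e / 8]. *)
pose T := (A * B) / r / (e / 8).
have T0 : 0 <= T by rewrite !divr_ge0// ltW// divr_gt0.
pose m := (Num.truncn (T `^ r^-1)).+1.
have m0 : 0 < m%:R :> R by rewrite ltr0n.
have mT : T <= m%:R `^ r.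
  have -> : T = (T `^ r^-1) `^ r by rewrite -powRrM mulVf ?gt_eqF// powRr1.
  by rewrite ge0_ler_powR ?nnegrE ?powR_ge0 ?(ltW r0) ?(ltW m0)// ltW// truncnS_gt.
pose eps := e / 16 / m%:R.
have eps0 : 0 < eps by rewrite !divr_gt0.
have bound (W : normedModType R) (h : R -> W) s : 1 < s -> Up s a b h ->
    forall x y, a <= x <= b -> a <= y <= b ->
    `|h y - h x| <= 2 * fine (pTV_norm s h a b).
  move=> s1 hU x y /andP[ax xb] /andP[ay yb].
  by have [xy|yx] := leP x y; [|rewrite distrC]; rewrite increment_le// ltW.
have [d d0 small] :=
  no_common_discontinuity_small (bound _ f p p1 fU) (bound _ g q q1 gU) fg eps0.
exists d => // P Q Pd Qd.
(* The trivial last factor gives the shape of [sum_min_powR] with [alpha = 1 / p + 1 / q] and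
   [beta = 0]. *)
pose c k := Num.min eps (A * B * k%:R `^ (- (p^-1 + q^-1))) * k%:R `^ (- 0).
have cost n : \sum_(1 <= k < n.+1) c k <= e / 4.
  have b01 : 0 <= (0 : R) < 1 by rewrite lexx ltr01.
  have pq0 : 1 < p^-1 + q^-1 + 0 by rewrite addr0.
  have := sum_min_powR n b01 pq0 AB0 (ltW eps0) (ltn0Sn _ : (0 < m)%N).
  move=> /le_trans; apply.
  have -> : e / 4 = e / 8 + e / 8 by field.
  rewrite addr0 -/r; apply: lerD.
    rewrite subr0 powRr1 ?(ltW m0)// le_eqVlt; apply/orP; left; apply/eqP.
    by rewrite /eps; field; rewrite gt_eqF.
  rewrite powRN ler_pdivrMr ?powR_gt0// -ler_pdivrMl ?divr_gt0//.
  by apply: le_trans mT; rewrite le_eqVlt /T; apply/orP; left; apply/eqP; ring.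
have merge_le k v x x' u u' : (0 < k)%N ->
    a <= v -> v <= x -> x <= x' -> x' <= v + d -> x' <= b ->
    v <= u -> u <= u' -> u' <= v + d -> u' <= b ->
    `|f x' - f x| <= X k -> `|g u' - g u| <= Y k ->
    `|f x' - f x| * `|g u' - g u| <= c k.
  move=> k0 av vx xx' x'd x'b vu uu' u'd u'b fX gY.
  rewrite /c oppr0 powRr0 mulr1 le_min; apply/andP; split.
    have near_v z : v <= z -> z <= v + d -> `|z - v| <= d.
      by move=> vz zd; rewrite ger0_norm ?subr_ge0// lerBlDl.
    have in_ab z : v <= z -> z <= b -> a <= z <= b.
      by move=> vz ->; rewrite (le_trans av vz).
    have vx' := le_trans vx xx'; have vu' := le_trans vu uu'.
    have xb := le_trans xx' x'b; have ub := le_trans uu' u'b.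
    have xd := le_trans xx' x'd; have ud := le_trans uu' u'd.
    by apply: (small v); (exact: near_v || exact: in_ab || exact/in_ab/(le_trans vx xb)).
  apply: le_trans (ler_pM _ _ fX gY) _ => //.
  by rewrite /X /Y mulrACA opprD powRD// pnatr_eq0 -lt0n k0 implybT.
have -> : e = 4 * (e / 4) by field.
exact: (RS_sum_close (ltW ab) few_jumps merge_le cost (ltW d0) Pd Qd).
Qed.

End integral.

(** * Uniform partitions and existence of the integral *)

Section uniform_partition.
Context {R : realType}.
Variables (a b : R) (ab : a < b) (n : nat).

Let node (i : nat) : R := a + (b - a) * i%:R / n.+1%:R.

Let node_lt i : node i < node i.+1.
Proof.
rewrite /node ltrD2l ltr_pM2r ?invr_gt0 ?ltr0n// ltr_pM2l ?subr_gt0//.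
by rewrite ltr_nat.
Qed.

Let node_first : node 0 = a. Proof. by rewrite /node mulr0 mul0r addr0. Qed.

Let node_last : node n.+1 = b.
Proof. by rewrite /node mulfK ?pnatr_eq0// addrC subrK. Qed.

Let tag_in i : (i < n.+1)%N -> node i \in `[node i, node i.+1].
Proof. by rewrite in_itv/= lexx ltW. Qed.

Definition uniform_partition : tagged_partition a b :=
  TaggedPartition node_first node_last (fun i _ => node_lt i) tag_in.

Lemma tp_mesh_uniform_partition : tp_mesh uniform_partition <= (b - a) / n.+1%:R.
Proof.
apply: bigmax_le => [|i _ /=]; first by rewrite divr_ge0// subr_ge0 ltW.
rewrite /node -natr1 le_eqVlt; apply/orP; left; apply/eqP; ring.
Qed.

End uniform_partition.

Lemma tp_mesh_uniform_partition_cvg0 (R : realType) (a b : R) (ab : a < b) :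
  tp_mesh (uniform_partition ab n) @[n --> \oo] --> (0 : R).
Proof.
apply/cvgrPdist_le => e e0; exists (Num.truncn ((b - a) / e)) => // n /= nd.
rewrite sub0r normrN ger0_norm; last exact: bigmax_ge_id.
apply: le_trans (tp_mesh_uniform_partition ab n) _.
rewrite ler_pdivrMr ?ltr0n// mulrC -ler_pdivrMr//.
by apply: le_trans (ltW (truncnS_gt _)) _; rewrite ler_nat.
Qed.

(** Completeness of [V] gives a limit along the uniform partitions; sums along any other sequence
    with mesh tending to 0 end up close to those. *)
Lemma is_RS_integral_exists (R : realType) (E : normedModType R)
    (V : completeNormedModType R) (a b : R) (f : R -> contlin E V) (g : R -> E) :
  a < b ->
  (forall e, 0 < e -> exists2 d, 0 < d & forall P Q : tagged_partition a b,
    tp_mesh P <= d -> tp_mesh Q <= d -> `|RS_sum f g P - RS_sum f g Q| <= e) ->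
  exists I : V, is_RS_integral f g a b I.
Proof.
move=> ab close; pose U n := uniform_partition ab n.
have U_fine d : 0 < d -> \forall n \near \oo, tp_mesh (U n) <= d.
  move=> d0; have /cvgrPdist_le/(_ _ d0) := tp_mesh_uniform_partition_cvg0 ab.
  by apply: filterS => n; rewrite sub0r normrN => /(le_trans (ler_norm _)).
have cU : cvg (RS_sum f g (U n) @[n --> \oo]).
  apply: cauchy_cvg; apply: cauchy_exP => e e0.
  have [d d0 Hd] := close (e / 2) (divr_gt0 e0 (ltr0n _ 2)).
  have [N _ HN] := U_fine d d0.
  exists (RS_sum f g (U N)); rewrite -ball_normE; exists N => // n /= Nn.
  apply: le_lt_trans (Hd _ _ _ _) _; [exact: HN (leqnn N)|exact: HN|].
  by rewrite ltr_pdivrMr//; lra.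
exists (lim (RS_sum f g (U n) @[n --> \oo])) => P Pm.
apply/cvgrPdist_lt => e e0.
have e2 : 0 < e / 2 by rewrite divr_gt0.
have [d d0 Hd] := close (e / 2) e2.
have /cvgrPdist_lt/(_ _ e2) nearU := cU.
have /cvgrPdist_lt/(_ _ d0) nearP := Pm.
near=> k.
near \oo => n.
rewrite -(subrKA (RS_sum f g (U n))) (le_lt_trans (ler_normD _ _))//.
have -> : e = e / 2 + e / 2 by field.
apply: ltr_leD; first by near: n.
apply: Hd; first by near: n; exact: U_fine.
have : `|0 - tp_mesh (P k)| < d by near: k.
by rewrite sub0r normrN => /ltW; apply: le_trans; exact: ler_norm.
Unshelve. all: by end_near. Qed.

Theorem mainTheorem4 (R : realType) (p q : R) (hp : 1 < p) (hq : 1 < q)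
    (hpq : 1 < p^-1 + q^-1) :
  exists C : R,
    forall (E V : completeNormedModType R) (a b : R)
      (f : R -> contlin E V) (g : R -> E),
    a < b ->
    Up p a b f ->
    Up q a b g ->
    no_common_discontinuity f g a b ->
    exists I : V,
      is_RS_integral f g a b I /\
      (`|I - f a (g b - g a)|%:E <=
        C%:E * pTV_norm p f a b `^ (p - p / q)
             * osc_norm f a b `^ (1 + p / q - p)
             * pTV_norm q g a b)%E.
Proof.
exists (young_const p q) => E V a b f g ab fU gU fg.
have [I HI] := is_RS_integral_exists ab
  (fun e => RS_sum_cauchy hp hq hpq ab fU gU fg (e := e)).
exists I; split => //.
have [Ef _] := pTV_norm_fin_num (ltW ab) fU.
have [Eg _] := pTV_norm_fin_num (ltW ab) gU.
have [Eo _] := osc_norm_fin_num hp ab fU.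
(* All norms being finite, the extended inequality becomes a real one. *)
rewrite Ef Eg Eo !poweR_EFin -!EFinM lee_fin.
have cS := HI _ (tp_mesh_uniform_partition_cvg0 ab).
set M := (X in _ <= X).
(* The estimate holds for every Riemann sum and defines a closed set, so it passes to the limit
   along uniform partitions. *)
pose D := (Num.norm : V -> R) @^-1` [set y | y <= M].
apply: (@closed_cvg _ _ \oo _
  (fun k => RS_sum f g (uniform_partition ab k) - f a (g b - g a)) D).
- by apply: preimage_closed => [? _|]; [exact: norm_continuous|exact: closed_le].
- by apply: nearW => k; exact: RS_sum_young.
- by apply: cvgB; [exact: cS|exact: cvg_cst].
Qed.
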